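(* Let $M=U\subset\mathbb R^2$ be open, let $(U,F)$ be a conic pseudo-Finsler surface with $F$ defined on the conic sub-bundle $\mathcal A$, let $\phi:\mathcal A\to\mathbb R$ be a smooth function positively homogeneous of degree $0$ in $y$ with $\sigma+\varepsilon-(\phi_{;2})^2\neq0$ on $\mathcal A$, where $\sigma=\phi_{;2;2}+\varepsilon\mathcal I\phi_{;2}+2(\phi_{;2})^2$, and let $\overline F=e^{\phi}F$. Put $\rho=1/(\sigma+\varepsilon-(\phi_{;2})^2)$ and $2Q=\varepsilon\rho F^2(\phi_{;2}\phi_{,1}+\phi_{,1;2}-2\phi_{,2})$. Then: (i) a necessary condition for $\overline F$ to be projectively flat is that $Q+\varepsilon G^km_k=0$; (ii) a sufficient condition for $\overline F$ to be projectively flat is that $F\partial_j\phi+\partial_jF=0$ for $j=1,2$.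
   Context: $(x^1,x^2)$ are the standard coordinates on $U\subset\mathbb R^2$ and $(x^i,y^i)$ the induced coordinates on $TU$; repeated indices are summed over $\{1,2\}$. Write $\partial_i=\partial/\partial x^i$, $\dot\partial_i=\partial/\partial y^i$. A function is $h(r)$ if it is positively homogeneous of degree $r$ in $y$. A conic sub-bundle is a non-empty open subset $\mathcal A\subset TU\setminus 0$ projecting onto $U$ and closed under multiplication by positive scalars. A conic pseudo-Finsler metric is a smooth $h(1)$ function $F:\mathcal A\to\mathbb R$ such that $g_{ij}=\tfrac12\dot\partial_i\dot\partial_jF^2$ is non-degenerate at each point of $\mathcal A$; $(g^{ij})$ is the inverse matrix. A conic pseudo-Finsler surface is equipped with its modified Berwald frame: $F$ is nowhere zero on $\mathcal A$, $\ell_i=\dot\partial_iF$, $\ell^i=y^i/F$, $\varepsilon\in\{1,-1\}$ (the signature) is the sign of $\det(g_{ij})$, $m_1=-\sqrt{\varepsilon\det(g_{ij})}\,\ell^2$, $m_2=\sqrt{\varepsilon\det(g_{ij})}\,\ell^1$, $m^i=g^{ij}m_j$; thus $g_{ij}=\ell_i\ell_j+\varepsilon m_im_j$, $\ell^im_i=0$, $m^im_i=\varepsilon$. The main scalar $\mathcal I$ is defined by $F\,C_{ijk}=\mathcal I\,m_im_jm_k$, where $C_{ijk}=\tfrac12\dot\partial_kg_{ij}$. The geodesic spray coefficients of $F$ are $G^i=\tfrac14g^{ij}(y^k\dot\partial_j\partial_kF^2-\partial_jF^2)$; $G^j_i=\dot\partial_iG^j$ and $\delta_i=\partial_i-G^j_i\dot\partial_j$.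 The condition $\sigma+\varepsilon-(\phi_{;2})^2\ne0$ guarantees that $\overline F$ is a conic pseudo-Finsler metric. A conic pseudo-Finsler metric $F$ on $U$ is projectively flat if $y^j\partial_j\dot\partial_iF=\partial_iF$ for all $i$ (equivalently $\dot\partial_i(y^j\partial_jF)=2\partial_iF$; equivalently $G^i=\mathcal Py^i$ with $\mathcal P=y^k\partial_kF/(2F)$). For a smooth function $f$ on $\mathcal A$: $f_{;2}:=\varepsilon F(\dot\partial_if)m^i$, $f_{,1}:=(\delta_if)\ell^i$, $f_{,2}:=\varepsilon(\delta_if)m^i$, and iterated symbols are read left to right, e.g. $f_{;2;2}=(f_{;2})_{;2}$, $f_{,1;2}=(f_{,1})_{;2}$. *)

(* Defs.v *)
From Stdlib Require Export Reals ZArith.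
From Coquelicot Require Export Coquelicot.

Open Scope R_scope.

(** Points of [TU] are pairs [(x, y)] with [x] in [U] and [y] a tangent vector,
    in the induced coordinates.  A function on an open subset [A] of [TU] is
    represented by a total function, of which only the values on [A] matter. *)

Definition plane : Type := (R * R)%type.
Definition tangent : Type := (plane * plane)%type.

Inductive index : Set := i1 | i2.

Definition sum2 (f : index -> R) : R := f i1 + f i2.

Definition coord (i : index) (v : plane) : R :=
  match i with i1 => fst v | i2 => snd v end.

Definition set_coord (i : index) (v : plane) (t : R) : plane :=
  match i with i1 => (t, snd v) | i2 => (fst v, t) end.

Definition slice_x (i : index) (f : tangent -> R) (p : tangent) (t : R) : R :=
  f (set_coord i (fst p) t, snd p).

Definition slice_y (i : index) (f : tangent -> R) (p : tangent) (t : R) : R :=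
  f (fst p, set_coord i (snd p) t).

Definition dx (i : index) (f : tangent -> R) (p : tangent) : R :=
  Derive (slice_x i f p) (coord i (fst p)).

Definition dy (i : index) (f : tangent -> R) (p : tangent) : R :=
  Derive (slice_y i f p) (coord i (snd p)).

Fixpoint Ck_on (A : tangent -> Prop) (n : nat) (f : tangent -> R) : Prop :=
  (forall p, A p -> continuous f p) /\
  match n with
  | O => True
  | S n' =>
      forall i,
        (forall p, A p ->
           ex_derive (slice_x i f p) (coord i (fst p)) /\
           ex_derive (slice_y i f p) (coord i (snd p))) /\
        Ck_on A n' (dx i f) /\
        Ck_on A n' (dy i f)
  end.

Definition smooth_on (A : tangent -> Prop) (f : tangent -> R) : Prop :=
  forall n, Ck_on A n f.

Definition dilate (t : R) (v : plane) : plane := (t * fst v, t * snd v).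

Definition homogeneous_on (A : tangent -> Prop) (r : Z) (f : tangent -> R) : Prop :=
  forall x y t, A (x, y) -> 0 < t -> f (x, dilate t y) = powerRZ t r * f (x, y).

Record conic_subbundle (U : plane -> Prop) (A : tangent -> Prop) : Prop := {
  conic_nonempty : exists p, A p;
  conic_open : open A;
  conic_over : forall x y, A (x, y) -> U x;
  conic_slit : forall x y, A (x, y) -> y <> (0, 0);
  conic_onto : forall x, U x -> exists y, A (x, y);
  conic_dilate : forall x y t, A (x, y) -> 0 < t -> A (x, dilate t y)
}.

Definition g (F : tangent -> R) (i j : index) : tangent -> R :=
  fun p => / 2 * dy i (dy j (fun q => F q ^ 2)) p.

Definition det_g (F : tangent -> R) : tangent -> R :=
  fun p => g F i1 i1 p * g F i2 i2 p - g F i1 i2 p * g F i2 i1 p.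

(** Inverse of the 2 x 2 matrix [g]: adjugate over determinant. *)
Definition g_inv (F : tangent -> R) (i j : index) : tangent -> R :=
  fun p =>
    match i, j with
    | i1, i1 => g F i2 i2 p
    | i1, i2 => - g F i1 i2 p
    | i2, i1 => - g F i2 i1 p
    | i2, i2 => g F i1 i1 p
    end / det_g F p.

Record conic_pseudo_Finsler_metric
    (U : plane -> Prop) (A : tangent -> Prop) (F : tangent -> R) : Prop := {
  metric_domain : conic_subbundle U A;
  metric_smooth : smooth_on A F;
  metric_homogeneous : homogeneous_on A 1 F;
  metric_nondegenerate : forall p, A p -> det_g F p <> 0
}.

(** The data needed for the modified Berwald frame: [F] vanishes nowhere and
    [eps] is the signature, i.e. the sign of [det_g F] on [A]. *)
Record conic_pseudo_Finsler_surface
    (U : plane -> Prop) (A : tangent -> Prop) (F : tangent -> R) (eps : R) : Prop := {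
  surface_metric : conic_pseudo_Finsler_metric U A F;
  surface_nonzero : forall p, A p -> F p <> 0;
  surface_signature : eps = 1 \/ eps = -1;
  surface_sign : forall p, A p -> sign (det_g F p) = eps
}.

Definition ell_up (F : tangent -> R) (i : index) : tangent -> R :=
  fun p => coord i (snd p) / F p.

Definition m_low (F : tangent -> R) (eps : R) (i : index) : tangent -> R :=
  fun p =>
    match i with
    | i1 => - sqrt (eps * det_g F p) * ell_up F i2 p
    | i2 => sqrt (eps * det_g F p) * ell_up F i1 p
    end.

Definition m_up (F : tangent -> R) (eps : R) (i : index) : tangent -> R :=
  fun p => sum2 (fun j => g_inv F i j p * m_low F eps j p).

Definition Cartan (F : tangent -> R) (i j k : index) : tangent -> R :=
  fun p => / 2 * dy k (g F i j) p.

(** For a conic pseudo-Finsler surface this determines [I] uniquely on [A]. *)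
Definition is_main_scalar
    (A : tangent -> Prop) (F : tangent -> R) (eps : R) (I : tangent -> R) : Prop :=
  forall p, A p -> forall i j k,
    F p * Cartan F i j k p = I p * m_low F eps i p * m_low F eps j p * m_low F eps k p.

Definition spray (F : tangent -> R) (i : index) : tangent -> R :=
  fun p => / 4 * sum2 (fun j =>
    g_inv F i j p *
    (sum2 (fun k => coord k (snd p) * dy j (dx k (fun q => F q ^ 2)) p)
     - dx j (fun q => F q ^ 2) p)).

Definition delta (F : tangent -> R) (i : index) (f : tangent -> R) : tangent -> R :=
  fun p => dx i f p - sum2 (fun j => dy i (spray F j) p * dy j f p).

(** [semi2], [comma1], [comma2] are the derivatives written [f_{;2}], [f_{,1}],
    [f_{,2}]; iterated subscripts read left to right, so that [f_{,1;2}] is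
    [semi2 F eps (comma1 F f)]. *)

Definition semi2 (F : tangent -> R) (eps : R) (f : tangent -> R) : tangent -> R :=
  fun p => eps * F p * sum2 (fun i => dy i f p * m_up F eps i p).

Definition comma1 (F : tangent -> R) (f : tangent -> R) : tangent -> R :=
  fun p => sum2 (fun i => delta F i f p * ell_up F i p).

Definition comma2 (F : tangent -> R) (eps : R) (f : tangent -> R) : tangent -> R :=
  fun p => eps * sum2 (fun i => delta F i f p * m_up F eps i p).

Definition projectively_flat (A : tangent -> Prop) (F : tangent -> R) : Prop :=
  forall p, A p -> forall i,
    sum2 (fun j => coord j (snd p) * dx j (dy i F) p) = dx i F p.

Definition Fbar (F phi : tangent -> R) : tangent -> R :=
  fun p => exp (phi p) * F p.

Definition sigma_phi (F : tangent -> R) (eps : R) (I phi : tangent -> R) : tangent -> R :=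
  fun p => semi2 F eps (semi2 F eps phi) p
           + eps * I p * semi2 F eps phi p
           + 2 * semi2 F eps phi p ^ 2.

Definition rho_phi (F : tangent -> R) (eps : R) (I phi : tangent -> R) : tangent -> R :=
  fun p => 1 / (sigma_phi F eps I phi p + eps - semi2 F eps phi p ^ 2).

Definition Q_phi (F : tangent -> R) (eps : R) (I phi : tangent -> R) : tangent -> R :=
  fun p => (eps * rho_phi F eps I phi p * F p ^ 2 *
            (semi2 F eps phi p * comma1 F phi p
             + semi2 F eps (comma1 F phi) p
             - 2 * comma2 F eps phi p)) / 2.

(* Main.v *)
Require Import Defs.
From Stdlib Require Import Reals ZArith Lra ssreflect.
From Coquelicot Require Import Coquelicot.

Open Scope R_scope.

(** (ii) The hypothesis says that [dx j (Fbar F phi) = 0], and mixed partial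
    derivatives commute.

    (i) The fibre Hessian of [F] is [det g / F^3] times the square of
    [n = (- y^2, y^1)], and the frame vector [m] is proportional to
    [v = (- dF/dy^2, dF/dy^1)], with [v(F) = 0] and [n(v) = F].  Contracting the
    equations of projective flatness of [exp(phi) F] with [v] gives one scalar
    equation.  The Euler-Lagrange form of the spray,
    [y^k d_k F_i - d_i F = 2 G^k F_ik], removes the derivatives [d_i F] from it,
    and the decomposition [F G = (G^k F_k) y + n(G) v] together with Euler's
    identities turns what is left into
    [F^3 (phi_;2 phi_,1 + phi_,1;2 - 2 phi_,2) = - 2 sqrt(eps det g) n(G) / rho],
    which is the claim because [m_k = sqrt(eps det g) n_k / F]. *)

(** * Smooth functions and their partial derivatives *)

(** The four coordinate directions of the tangent bundle are treated uniformly, so that each rule of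
    calculus is proved once; [dx i] and [dy i] are convertible to [partial (base i)] and
    [partial (fibre i)]. *)
Inductive direction := base (i : index) | fibre (i : index).

Definition coordinate (d : direction) (p : tangent) : R :=
  match d with base i => coord i (fst p) | fibre i => coord i (snd p) end.

Definition move (d : direction) (p : tangent) (t : R) : tangent :=
  match d with
  | base i => (set_coord i (fst p) t, snd p)
  | fibre i => (fst p, set_coord i (snd p) t)
  end.

Definition partial (d : direction) (f : tangent -> R) (p : tangent) : R :=
  Derive (fun t => f (move d p t)) (coordinate d p).

(** Unlike [partial], which is total because [Derive] is, this relation also asserts that the
    derivative exists. *)
Definition is_partial (d : direction) (f : tangent -> R) (p : tangent) (l : R) : Prop :=
  is_derive (fun t => f (move d p t)) (coordinate d p) l.

Lemma move_coordinate (d : direction) (p : tangent) : move d p (coordinate d p) = p.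
Proof. destruct d as [[]|[]], p as [[] []]; reflexivity. Qed.

Lemma coordinate_move (d : direction) (p : tangent) (t : R) : coordinate d (move d p t) = t.
Proof. destruct d as [[]|[]], p as [[] []]; reflexivity. Qed.

Lemma move_move (d : direction) (p : tangent) (s t : R) : move d (move d p s) t = move d p t.
Proof. destruct d as [[]|[]], p as [[] []]; reflexivity. Qed.

Lemma direction_eq_dec (d e : direction) : {d = e} + {d <> e}.
Proof. repeat decide equality. Defined.

Definition kronecker (d e : direction) : R :=
  match direction_eq_dec d e with left _ => 1 | right _ => 0 end.

Lemma coordinate_move_neq (d e : direction) (p : tangent) (t : R) :
  d <> e -> coordinate d (move e p t) = coordinate d p.
Proof. destruct d as [[]|[]], e as [[]|[]], p as [[] []]; try reflexivity; now intros []. Qed.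

Lemma move_comm (d e : direction) (p : tangent) (s t : R) :
  d <> e -> move d (move e p t) s = move e (move d p s) t.
Proof. destruct d as [[]|[]], e as [[]|[]], p as [[] []]; try reflexivity; now intros []. Qed.

Lemma ball_move (d e : direction) (p : tangent) (s t r : R) :
  Rabs (s - coordinate d p) < r -> Rabs (t - coordinate e p) < r -> 0 < r ->
  ball p r (move d (move e p t) s).
Proof.
  intros Hs Ht Hr.
  assert (H0 : forall x : R, Rabs (x - x) < r)
    by (intros x; rewrite Rminus_diag Rabs_R0; exact Hr).
  destruct d as [[]|[]], e as [[]|[]], p as [[] []];
    repeat split; first [exact Hs | exact Ht | exact (H0 _)].
Qed.

Lemma near_move (A : tangent -> Prop) (d : direction) (p : tangent) :
  open A -> A p -> locally (coordinate d p) (fun t => A (move d p t)).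
Proof.
  intros oA Ap. destruct (oA p Ap) as [r Hr]. exists r. intros t Ht.
  apply Hr. rewrite <- (move_move d p t t).
  apply ball_move; try exact Ht; apply cond_pos.
Qed.

Lemma near_move2 (A : tangent -> Prop) (d e : direction) (p : tangent) :
  open A -> A p ->
  locally_2d (fun s t => A (move d (move e p t) s)) (coordinate d p) (coordinate e p).
Proof.
  intros oA Ap. destruct (oA p Ap) as [r Hr]. exists r. intros s t Hs Ht.
  apply Hr, ball_move; auto; apply cond_pos.
Qed.

Lemma continuous_coordinate (d : direction) (p : tangent) :
  continuous (coordinate d) p.
Proof.
  intros P [r Hr]. exists r. intros q Hq. apply Hr.
  destruct d as [[]|[]]; apply Hq.
Qed.

(** Since [A] is open, a short coordinate segment through [p] stays in [A]; identities known only on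
    [A] may therefore be differentiated. *)
Lemma is_partial_ext (A : tangent -> Prop) (d : direction) (f h : tangent -> R) (p : tangent) (l : R) :
  open A -> A p -> (forall q, A q -> f q = h q) ->
  is_partial d f p l -> is_partial d h p l.
Proof.
  intros oA Ap E. apply is_derive_ext_loc.
  apply: filter_imp (near_move A d p oA Ap) => t. apply E.
Qed.

Lemma partial_ext (A : tangent -> Prop) (d : direction) (f h : tangent -> R) (p : tangent) :
  open A -> A p -> (forall q, A q -> f q = h q) -> partial d f p = partial d h p.
Proof.
  intros oA Ap E. apply Derive_ext_loc.
  apply: filter_imp (near_move A d p oA Ap) => t. apply E.
Qed.

Lemma is_partial_unique (d : direction) (f : tangent -> R) (p : tangent) (l : R) :
  is_partial d f p l -> partial d f p = l.
Proof. apply is_derive_unique. Qed.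

(** * Differentiation rules *)

Lemma is_partial_const (d : direction) (c : R) (p : tangent) :
  is_partial d (fun _ => c) p 0.
Proof. apply: is_derive_const. Qed.

Lemma is_partial_coordinate (d e : direction) (p : tangent) :
  is_partial d (coordinate e) p (kronecker d e).
Proof.
  unfold is_partial, kronecker. destruct (direction_eq_dec d e) as [<-|N].
  - apply (is_derive_ext (fun t => t)); [intros t; now rewrite coordinate_move|].
    apply: is_derive_id.
  - apply (is_derive_ext (fun _ => coordinate e p)).
    + intros t. rewrite coordinate_move_neq; auto.
    + apply: is_derive_const.
Qed.

Lemma is_partial_plus (d : direction) (f h : tangent -> R) (p : tangent) (a b : R) :
  is_partial d f p a -> is_partial d h p b ->
  is_partial d (fun q => f q + h q) p (a + b).
Proof. apply: is_derive_plus. Qed.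

Lemma is_partial_mult (d : direction) (f h : tangent -> R) (p : tangent) (a b : R) :
  is_partial d f p a -> is_partial d h p b ->
  is_partial d (fun q => f q * h q) p (a * h p + f p * b).
Proof.
  intros Ha Hb. generalize (Derive.is_derive_mult _ _ _ _ _ Ha Hb).
  now rewrite move_coordinate.
Qed.

Lemma is_partial_inv (d : direction) (f : tangent -> R) (p : tangent) (a : R) :
  f p <> 0 -> is_partial d f p a -> is_partial d (fun q => / f q) p (- a / f p ^ 2).
Proof.
  intros N Ha. generalize (is_derive_inv _ _ _ Ha). rewrite move_coordinate. intros H. exact (H N).
Qed.

Lemma is_partial_sqrt (d : direction) (f : tangent -> R) (p : tangent) (a : R) :
  0 < f p -> is_partial d f p a ->
  is_partial d (fun q => sqrt (f q)) p (a / (2 * sqrt (f p))).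
Proof.
  intros N Ha. generalize (is_derive_sqrt _ _ _ Ha). rewrite move_coordinate. intros H. exact (H N).
Qed.

Lemma is_partial_exp (d : direction) (f : tangent -> R) (p : tangent) (a : R) :
  is_partial d f p a -> is_partial d (fun q => exp (f q)) p (a * exp (f p)).
Proof.
  intros Ha. generalize (is_derive_comp _ _ _ _ _ (is_derive_exp _) Ha).
  now rewrite move_coordinate.
Qed.

(** * Closure properties of smooth functions *)

Lemma Ck_on_S (A : tangent -> Prop) (n : nat) (f : tangent -> R) :
  Ck_on A (S n) f <->
  (forall p, A p -> continuous f p) /\
  forall d, (forall p, A p -> is_partial d f p (partial d f p)) /\ Ck_on A n (partial d f).
Proof.
  split.
  - intros [c H]. split; [exact c|]. intros [i|i]; destruct (H i) as (D & Hx & Hy);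
      split; auto; intros p Ap; apply Derive_correct, (D p Ap).
  - intros [c H]. split; [exact c|]. intros i.
    destruct (H (base i)) as [Dx Hx], (H (fibre i)) as [Dy Hy].
    split; [|split; assumption].
    intros p Ap; split; eexists; [apply (Dx p Ap) | apply (Dy p Ap)].
Qed.

Lemma smooth_on_continuous (A : tangent -> Prop) (f : tangent -> R) (p : tangent) :
  smooth_on A f -> A p -> continuous f p.
Proof. intros H. apply (H O). Qed.

Lemma smooth_on_is_partial (A : tangent -> Prop) (f : tangent -> R) (d : direction) (p : tangent) :
  smooth_on A f -> A p -> is_partial d f p (partial d f p).
Proof. intros H. apply (proj1 (Ck_on_S A 0 f) (H 1%nat)). Qed.

Lemma smooth_on_partial (A : tangent -> Prop) (f : tangent -> R) (d : direction) :
  smooth_on A f -> smooth_on A (partial d f).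
Proof. intros H n. apply (proj1 (Ck_on_S A n f) (H (S n))). Qed.

(** Partial derivatives of members are again members, so all members are smooth:
    this gives closure of [smooth_on] under all the operations by one induction. *)
Inductive smooth_expr (A : tangent -> Prop) : (tangent -> R) -> Prop :=
| expr_smooth f : smooth_on A f -> smooth_expr A f
| expr_const c : smooth_expr A (fun _ => c)
| expr_coordinate d : smooth_expr A (coordinate d)
| expr_plus f h : smooth_expr A f -> smooth_expr A h -> smooth_expr A (fun p => f p + h p)
| expr_mult f h : smooth_expr A f -> smooth_expr A h -> smooth_expr A (fun p => f p * h p)
| expr_inv f : (forall p, A p -> f p <> 0) -> smooth_expr A f -> smooth_expr A (fun p => / f p)
| expr_sqrt f : (forall p, A p -> 0 < f p) -> smooth_expr A f -> smooth_expr A (fun p => sqrt (f p))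
| expr_exp f : smooth_expr A f -> smooth_expr A (fun p => exp (f p))
| expr_ext f h : (forall p, A p -> f p = h p) -> smooth_expr A f -> smooth_expr A h.

Lemma smooth_expr_C1 (A : tangent -> Prop) (f : tangent -> R) :
  open A -> smooth_expr A f ->
  (forall p, A p -> continuous f p) /\
  forall d, exists f', smooth_expr A f' /\ forall p, A p -> is_partial d f p (f' p).
Proof.
  intros oA.
  induction 1 as [f Hf|c|e|f h Hf [cf IHf] Hh [ch IHh]|f h Hf [cf IHf] Hh [ch IHh]
    |f N Hf [cf IHf]|f N Hf [cf IHf]|f Hf [cf IHf]|f h E Hf [cf IHf]].
  - split; [intros p; now apply smooth_on_continuous|]. intros d. exists (partial d f).
    split; [now apply expr_smooth, smooth_on_partial|].
    intros p. now apply smooth_on_is_partial.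
  - split; [intros p _; apply continuous_const|]. intros d.
    exists (fun _ => 0). split; [apply expr_const|]. intros p _. apply is_partial_const.
  - split; [intros p _; apply continuous_coordinate|]. intros d.
    exists (fun _ => kronecker d e).
    split; [apply expr_const|]. intros p _. apply is_partial_coordinate.
  - split; [intros p Ap; now apply (continuous_plus f h); [apply cf|apply ch]|]. intros d.
    destruct (IHf d) as (f' & Sf & Df), (IHh d) as (h' & Sh & Dh).
    exists (fun p => f' p + h' p). split; [now apply expr_plus|].
    intros p Ap. now apply is_partial_plus; auto.
  - split; [intros p Ap; now apply (continuous_mult f h); [apply cf|apply ch]|]. intros d.
    destruct (IHf d) as (f' & Sf & Df), (IHh d) as (h' & Sh & Dh).
    exists (fun p => f' p * h p + f p * h' p).
    split; [now apply expr_plus; apply expr_mult|].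
    intros p Ap. now apply is_partial_mult; auto.
  - split; [intros p Ap; apply: continuous_comp (cf p Ap) (continuous_Rinv _ (N p Ap))|].
    intros d. destruct (IHf d) as (f' & Sf & Df).
    (* The derivative is written with constructors of [smooth_expr] only, so that its membership is
       syntactic. *)
    exists (fun p => (-1 * f' p) * (/ f p * / f p)).
    split; [repeat (apply expr_mult || apply expr_inv || apply expr_const); auto|].
    intros p Ap. specialize (N p Ap).
    replace (-1 * f' p * (/ f p * / f p)) with (- f' p / f p ^ 2) by (field; auto).
    apply is_partial_inv; auto.
  - split; [intros p Ap; apply: continuous_comp (cf p Ap) (continuous_sqrt _)|].
    intros d. destruct (IHf d) as (f' & Sf & Df).
    exists (fun p => f' p * / (2 * sqrt (f p))).
    split.
    + apply expr_mult; [auto|]. apply expr_inv.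
      * intros p Ap. generalize (sqrt_lt_R0 _ (N p Ap)). lra.
      * apply expr_mult; [apply expr_const|now apply expr_sqrt].
    + intros p Ap. apply is_partial_sqrt; auto.
  - split; [intros p Ap; apply: continuous_comp (cf p Ap) (continuous_exp _)|].
    intros d. destruct (IHf d) as (f' & Sf & Df).
    exists (fun p => f' p * exp (f p)). split; [now apply expr_mult; [|apply expr_exp]|].
    intros p Ap. apply is_partial_exp; auto.
  - split.
    + intros p Ap. apply (continuous_ext_loc _ f); [|now apply cf].
      generalize (oA p Ap). apply filter_imp. exact E.
    + intros d. destruct (IHf d) as (f' & Sf & Df). exists f'. split; auto.
      intros p Ap. apply (is_partial_ext A d f); auto.
Qed.

(** Induction on the order, for all expressions at once, because a derivative is a different
    expression. It agrees with [partial d f] only on [A], which is what [expr_ext] absorbs. *)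
Lemma smooth_expr_smooth (A : tangent -> Prop) (f : tangent -> R) :
  open A -> smooth_expr A f -> smooth_on A f.
Proof.
  intros oA Hf n. revert f Hf. induction n as [|n IH]; intros f Hf;
    destruct (smooth_expr_C1 A f oA Hf) as [c D].
  - now split.
  - apply Ck_on_S. split; [exact c|]. intros d. destruct (D d) as (f' & Sf & Df). split.
    + intros p Ap. rewrite (is_partial_unique _ _ _ _ (Df p Ap)). auto.
    + apply IH, (expr_ext A f'); [|exact Sf].
      intros p Ap. symmetry. now apply is_partial_unique, Df.
Qed.

Lemma smooth_on_const (A : tangent -> Prop) (c : R) :
  open A -> smooth_on A (fun _ => c).
Proof. intros oA. now apply smooth_expr_smooth; [|apply expr_const]. Qed.

Lemma smooth_on_coord (A : tangent -> Prop) (i : index) :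
  open A -> smooth_on A (fun p => coord i (snd p)).
Proof. intros oA. now apply smooth_expr_smooth; [|apply (expr_coordinate A (fibre i))]. Qed.

Lemma smooth_on_plus (A : tangent -> Prop) (f h : tangent -> R) :
  open A -> smooth_on A f -> smooth_on A h -> smooth_on A (fun p => f p + h p).
Proof. intros oA Hf Hh. now apply smooth_expr_smooth; [|apply expr_plus; apply expr_smooth]. Qed.

Lemma smooth_on_mult (A : tangent -> Prop) (f h : tangent -> R) :
  open A -> smooth_on A f -> smooth_on A h -> smooth_on A (fun p => f p * h p).
Proof. intros oA Hf Hh. now apply smooth_expr_smooth; [|apply expr_mult; apply expr_smooth]. Qed.

Lemma smooth_on_inv (A : tangent -> Prop) (f : tangent -> R) :
  open A -> (forall p, A p -> f p <> 0) -> smooth_on A f -> smooth_on A (fun p => / f p).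
Proof. intros oA N Hf. now apply smooth_expr_smooth; [|apply expr_inv; [|apply expr_smooth]]. Qed.

Lemma smooth_on_sqrt (A : tangent -> Prop) (f : tangent -> R) :
  open A -> (forall p, A p -> 0 < f p) -> smooth_on A f -> smooth_on A (fun p => sqrt (f p)).
Proof. intros oA N Hf. now apply smooth_expr_smooth; [|apply expr_sqrt; [|apply expr_smooth]]. Qed.

Lemma smooth_on_exp (A : tangent -> Prop) (f : tangent -> R) :
  open A -> smooth_on A f -> smooth_on A (fun p => exp (f p)).
Proof. intros oA Hf. now apply smooth_expr_smooth; [|apply expr_exp, expr_smooth]. Qed.

Lemma smooth_on_ext (A : tangent -> Prop) (f h : tangent -> R) :
  open A -> (forall p, A p -> f p = h p) -> smooth_on A f -> smooth_on A h.
Proof. intros oA E Hf. apply smooth_expr_smooth; [auto|]. now apply (expr_ext A f), expr_smooth. Qed.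

(** * Symmetry of second partial derivatives *)

Lemma continuous_move2 (d e : direction) (f : tangent -> R) (p : tangent) :
  continuous f p ->
  continuity_2d_pt (fun s t => f (move d (move e p t) s)) (coordinate d p) (coordinate e p).
Proof.
  intros c r. rewrite !move_coordinate.
  destruct (proj1 (filterlim_locally _ _) c r) as [s Hs].
  exists s. intros u v Hu Hv. apply Hs. apply ball_move; auto; apply cond_pos.
Qed.

(** Schwarz's theorem for the restriction of [f] to the coordinate plane through [p] spanned by two
    distinct directions. *)
Lemma partial_comm (A : tangent -> Prop) (d e : direction) (f : tangent -> R) (p : tangent) :
  open A -> smooth_on A f -> A p ->
  partial d (partial e f) p = partial e (partial d f) p.
Proof.
  intros oA Hf Ap. destruct (direction_eq_dec d e) as [->|N]; [reflexivity|].
  (* [H1] to [H4] express the first and mixed partial derivatives at every point of that plane as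
     derivatives of the two-variable function to which [Schwarz] is applied. *)
  assert (H1 : forall s t, partial d f (move d (move e p t) s)
                = Derive (fun z => f (move d (move e p t) z)) s).
  { intros s t. unfold partial. rewrite coordinate_move. apply Derive_ext => z.
    now rewrite move_move. }
  assert (H2 : forall s t, partial e f (move d (move e p t) s)
                = Derive (fun z => f (move d (move e p z) s)) t).
  { intros s t. unfold partial. rewrite (move_comm d e) // coordinate_move.
    apply Derive_ext => z. now rewrite move_move (move_comm d e). }
  assert (H3 : forall s t, partial d (partial e f) (move d (move e p t) s)
                = Derive (fun z => Derive (fun y => f (move d (move e p y) z)) t) s).
  { intros s t. unfold partial at 1. rewrite coordinate_move. apply Derive_ext => z.
    now rewrite move_move H2. }
  assert (H4 : forall s t, partial e (partial d f) (move d (move e p t) s)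
                = Derive (fun z => Derive (fun y => f (move d (move e p z) y)) s) t).
  { intros s t. unfold partial at 1. rewrite (move_comm d e) // coordinate_move.
    apply Derive_ext => z. now rewrite move_move -(move_comm d e) // H1. }
  generalize (H3 (coordinate d p) (coordinate e p)) (H4 (coordinate d p) (coordinate e p)).
  rewrite !move_coordinate. intros -> ->.
  apply (Schwarz (fun s t => f (move d (move e p t) s))).
  - apply: locally_2d_impl (near_move2 A d e p oA Ap).
    apply locally_2d_forall. intros s t Aq.
    set (q := move d (move e p t) s) in *.
    generalize (smooth_on_is_partial A f d q Hf Aq)
      (smooth_on_is_partial A f e q Hf Aq)
      (smooth_on_is_partial A _ d q (smooth_on_partial A f e Hf) Aq)
      (smooth_on_is_partial A _ e q (smooth_on_partial A f d Hf) Aq).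
    unfold is_partial.
    assert (cd : coordinate d q = s) by apply coordinate_move.
    assert (ce : coordinate e q = t) by (unfold q; rewrite (move_comm d e) //; apply coordinate_move).
    assert (md : forall z, move d q z = move d (move e p t) z) by (intros z; apply move_move).
    assert (me : forall z, move e q z = move d (move e p z) s).
    { intros z. unfold q. rewrite (move_comm d e) // move_move -(move_comm d e) //. }
    rewrite cd ce. intros D1 D2 D3 D4. repeat split; eexists.
    + apply: is_derive_ext D1 => z. now rewrite md.
    + apply: is_derive_ext D2 => z. now rewrite me.
    + apply: is_derive_ext D3 => z. now rewrite md H2.
    + apply: is_derive_ext D4 => z. now rewrite me H1.
  - apply (continuity_2d_pt_ext (fun s t => partial d (partial e f) (move d (move e p t) s))).
    + intros s t. apply H3.
    + apply continuous_move2, (smooth_on_continuous A); auto using smooth_on_partial.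
  - apply (continuity_2d_pt_ext (fun s t => partial e (partial d f) (move d (move e p t) s))).
    + intros s t. apply H4.
    + apply continuous_move2, (smooth_on_continuous A); auto using smooth_on_partial.
Qed.

(** * The rules in terms of [dx] and [dy] *)

Lemma smooth_on_dx (A : tangent -> Prop) (f : tangent -> R) (i : index) :
  smooth_on A f -> smooth_on A (dx i f).
Proof. exact (smooth_on_partial A f (base i)). Qed.

Lemma smooth_on_dy (A : tangent -> Prop) (f : tangent -> R) (i : index) :
  smooth_on A f -> smooth_on A (dy i f).
Proof. exact (smooth_on_partial A f (fibre i)). Qed.

Lemma is_partial_eq (d : direction) (f : tangent -> R) (p : tangent) (a b : R) :
  is_partial d f p a -> a = b -> is_partial d f p b.
Proof. now intros H <-. Qed.

Lemma is_partial_minus (d : direction) (f h : tangent -> R) (p : tangent) (a b : R) :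
  is_partial d f p a -> is_partial d h p b -> is_partial d (fun q => f q - h q) p (a - b).
Proof. apply: is_derive_minus. Qed.

Lemma is_partial_div (d : direction) (f h : tangent -> R) (p : tangent) (a b : R) :
  h p <> 0 -> is_partial d f p a -> is_partial d h p b ->
  is_partial d (fun q => f q / h q) p ((a * h p - f p * b) / h p ^ 2).
Proof.
  intros N Ha Hb. eapply is_partial_eq.
  - apply is_partial_mult; [exact Ha|apply is_partial_inv; [exact N|exact Hb]].
  - cbv beta. field. exact N.
Qed.

Lemma smooth_on_is_dx (A : tangent -> Prop) (f : tangent -> R) (i : index) (p : tangent) :
  smooth_on A f -> A p -> is_partial (base i) f p (dx i f p).
Proof. apply smooth_on_is_partial. Qed.

Lemma smooth_on_is_dy (A : tangent -> Prop) (f : tangent -> R) (i : index) (p : tangent) :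
  smooth_on A f -> A p -> is_partial (fibre i) f p (dy i f p).
Proof. apply smooth_on_is_partial. Qed.

Lemma dx_eq (i : index) (f : tangent -> R) (p : tangent) (l : R) :
  is_partial (base i) f p l -> dx i f p = l.
Proof. apply is_derive_unique. Qed.

Lemma dy_eq (i : index) (f : tangent -> R) (p : tangent) (l : R) :
  is_partial (fibre i) f p l -> dy i f p = l.
Proof. apply is_derive_unique. Qed.

Lemma dx_ext (A : tangent -> Prop) (i : index) (f h : tangent -> R) (p : tangent) :
  open A -> A p -> (forall q, A q -> f q = h q) -> dx i f p = dx i h p.
Proof. exact (partial_ext A (base i) f h p). Qed.

Lemma dy_ext (A : tangent -> Prop) (i : index) (f h : tangent -> R) (p : tangent) :
  open A -> A p -> (forall q, A q -> f q = h q) -> dy i f p = dy i h p.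
Proof. exact (partial_ext A (fibre i) f h p). Qed.

Lemma dy_dy_comm (A : tangent -> Prop) (f : tangent -> R) (i j : index) (p : tangent) :
  open A -> smooth_on A f -> A p -> dy i (dy j f) p = dy j (dy i f) p.
Proof. exact (partial_comm A (fibre i) (fibre j) f p). Qed.

Lemma dy_dx_comm (A : tangent -> Prop) (f : tangent -> R) (i j : index) (p : tangent) :
  open A -> smooth_on A f -> A p -> dy i (dx j f) p = dx j (dy i f) p.
Proof. exact (partial_comm A (fibre i) (base j) f p). Qed.

(** * Euler's identities *)

(** The Euler (Liouville) field [y^i dy_i]: on smooth functions, homogeneity of
    degree [r] is handled through the identity [radial f = r f]. *)
Definition radial (f : tangent -> R) (p : tangent) : R :=
  coord i1 (snd p) * dy i1 f p + coord i2 (snd p) * dy i2 f p.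

Definition of_degree (A : tangent -> Prop) (r : R) (f : tangent -> R) : Prop :=
  smooth_on A f /\ forall p, A p -> radial f p = r * f p.

Lemma is_derive_powerRZ_1 (k : Z) : is_derive (fun t => powerRZ t k) 1 (IZR k).
Proof.
  assert (H : forall n, is_derive (fun t => t ^ n) 1 (INR n)).
  { intros n. generalize (is_derive_pow (fun t => t) n 1 1 (is_derive_id 1)).
    now rewrite pow1 !Rmult_1_r. }
  destruct k as [|n|n]; cbn.
  - apply: is_derive_const.
  - replace (IZR (Z.pos n)) with (INR (Pos.to_nat n)) by apply INR_IPR. apply H.
  - replace (IZR (Z.neg n)) with (- INR (Pos.to_nat n) / (1 ^ Pos.to_nat n) ^ 2).
    + apply is_derive_inv; [apply H|]. rewrite pow1. exact R1_neq_R0.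
    + rewrite !pow1 INR_IPR. change (IZR (Z.neg n)) with (- IPR n). field.
Qed.

(** Euler's theorem: the derivative of [t -> f (x, t y)] at [t = 1] is computed once by the chain
    rule and once from the homogeneity law. *)
Lemma homogeneous_of_degree (A : tangent -> Prop) (k : Z) (f : tangent -> R) :
  open A -> smooth_on A f -> homogeneous_on A k f -> of_degree A (IZR k) f.
Proof.
  intros oA Hf Hh. split; [exact Hf|]. intros [x [y1 y2]] Ap.
  assert (D : is_derive (fun t => f (x, (t * y1, t * y2))) 1
     (dy i1 f (x, (y1, y2)) * y1 + dy i2 f (x, (y1, y2)) * y2)).
  (* The chain rule needs total differentiability in the fibre; it follows from the existence of
     both partial derivatives, one of them near the point and continuous there. *)
  { apply is_derive_Reals.
    apply (derivable_pt_lim_comp_2d (fun u v => f (x, (u, v)))).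
    - apply filterdiff_differentiable_pt_lim. rewrite !Rmult_1_l.
      apply: filterdiff_ext_lin.
      + apply (is_derive_filterdiff (fun u v => f (x, (u, v))) y1 y2
          (fun u v => dy i1 f (x, (u, v))) (dy i2 f (x, (y1, y2)))).
        * apply (proj1 (locally_2d_locally (fun u v =>
            is_derive (fun z => f (x, (z, v))) u (dy i1 f (x, (u, v)))) y1 y2)).
          apply: locally_2d_impl (near_move2 A (fibre i1) (fibre i2) _ oA Ap).
          apply locally_2d_forall. intros u v Aq.
          apply (smooth_on_is_dy A f i1 _ Hf Aq).
        * apply (smooth_on_is_dy A f i2 _ Hf Ap).
        * apply (continuity_2d_pt_filterlim (fun u v => dy i1 f (x, (u, v)))).
          apply (continuous_move2 (fibre i1) (fibre i2) (dy i1 f) (x, (y1, y2))).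
          apply (smooth_on_continuous A); [now apply smooth_on_dy|exact Ap].
      + intros [u v]. reflexivity.
    - apply is_derive_Reals. auto_derive; [exact Logic.I|cbn; ring].
    - apply is_derive_Reals. auto_derive; [exact Logic.I|cbn; ring]. }
  assert (E : is_derive (fun t => f (x, (t * y1, t * y2))) 1 (IZR k * f (x, (y1, y2)))).
  { apply (is_derive_ext_loc (fun t => powerRZ t k * f (x, (y1, y2)))).
    (* The homogeneity law requires [t > 0], which holds on the ball of radius 1 about 1. *)
    - exists (mkposreal 1 Rlt_0_1). intros t Ht. symmetry. apply (Hh x (y1, y2)); [exact Ap|].
      apply Rabs_def2 in Ht. cbn in Ht. unfold minus, plus, opp in Ht; cbn in Ht. lra.
    - generalize (is_derive_scal_l _ _ _ (f (x, (y1, y2))) (is_derive_powerRZ_1 k)). auto. }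
  rewrite -(is_derive_unique _ _ _ E) (is_derive_unique _ _ _ D).
  rewrite (Rmult_comm _ y1) (Rmult_comm _ y2). reflexivity.
Qed.

(** * Degrees under arithmetic operations and differentiation *)

Section Degree.

Context (A : tangent -> Prop) (oA : open A).

Lemma of_degree_ext (r : R) (f h : tangent -> R) :
  (forall p, A p -> f p = h p) -> of_degree A r f -> of_degree A r h.
Proof.
  intros E [Sf Ef]. split; [exact (smooth_on_ext A f h oA E Sf)|].
  intros p Ap. rewrite -E // -Ef //. unfold radial.
  f_equal; f_equal; symmetry;
    apply (dy_ext A); auto.
Qed.

Lemma of_degree_const (c : R) : of_degree A 0 (fun _ => c).
Proof.
  split; [now apply smooth_on_const|]. intros p _. unfold radial.
  rewrite (dy_eq _ _ _ _ (is_partial_const (fibre i1) c p)).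
  rewrite (dy_eq _ _ _ _ (is_partial_const (fibre i2) c p)).
  cbv beta. ring.
Qed.

Lemma of_degree_coord (i : index) : of_degree A 1 (fun p => coord i (snd p)).
Proof.
  split; [now apply smooth_on_coord|]. intros p _. unfold radial.
  rewrite (dy_eq _ (fun q => coord i (snd q)) _ _ (is_partial_coordinate (fibre i1) (fibre i) p)).
  rewrite (dy_eq _ (fun q => coord i (snd q)) _ _ (is_partial_coordinate (fibre i2) (fibre i) p)).
  destruct i; cbn; ring.
Qed.

Lemma of_degree_plus (r : R) (f h : tangent -> R) :
  of_degree A r f -> of_degree A r h -> of_degree A r (fun p => f p + h p).
Proof.
  intros [Sf Ef] [Sh Eh]. split; [now apply smooth_on_plus|]. intros p Ap.
  assert (D : forall i, dy i (fun q => f q + h q) p = dy i f p + dy i h p).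
  { intros i. apply dy_eq.
    apply is_partial_plus; now apply (smooth_on_is_dy A). }
  transitivity (radial f p + radial h p).
  - unfold radial. rewrite !D. ring.
  - rewrite Ef // Eh //. ring.
Qed.

Lemma of_degree_mult (r s : R) (f h : tangent -> R) :
  of_degree A r f -> of_degree A s h -> of_degree A (r + s) (fun p => f p * h p).
Proof.
  intros [Sf Ef] [Sh Eh]. split; [now apply smooth_on_mult|]. intros p Ap.
  assert (D : forall i, dy i (fun q => f q * h q) p = dy i f p * h p + f p * dy i h p).
  { intros i. apply dy_eq.
    apply is_partial_mult; now apply (smooth_on_is_dy A). }
  transitivity (radial f p * h p + f p * radial h p).
  - unfold radial. rewrite !D. cbv beta. ring.
  - rewrite Ef // Eh //. ring.
Qed.

Lemma of_degree_minus (r : R) (f h : tangent -> R) :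
  of_degree A r f -> of_degree A r h -> of_degree A r (fun p => f p - h p).
Proof.
  intros Hf Hh. apply (of_degree_ext r (fun p => f p + -1 * h p)); [intros; ring|].
  apply of_degree_plus; [exact Hf|]. rewrite -(Rplus_0_l r).
  apply of_degree_mult; [apply of_degree_const|exact Hh].
Qed.

Lemma of_degree_inv (r : R) (f : tangent -> R) :
  (forall p, A p -> f p <> 0) -> of_degree A r f -> of_degree A (- r) (fun p => / f p).
Proof.
  intros N [Sf Ef]. split; [now apply smooth_on_inv|]. intros p Ap.
  assert (D : forall i, dy i (fun q => / f q) p = - dy i f p / f p ^ 2).
  { intros i. apply dy_eq.
    apply is_partial_inv; [exact (N p Ap)|now apply (smooth_on_is_dy A)]. }
  transitivity (- radial f p / f p ^ 2).
  - unfold radial. rewrite !D. field. exact (N p Ap).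
  - rewrite Ef //. field. exact (N p Ap).
Qed.

(** The commutator of a coordinate derivative with the Euler field: it vanishes for a base direction
    and is the derivative itself for a fibre direction. Hence [dx] preserves the degree and [dy]
    lowers it by one. *)
Lemma partial_radial (d : direction) (f : tangent -> R) (p : tangent) :
  smooth_on A f -> A p ->
  partial d (radial f) p = radial (partial d f) p
    + kronecker d (fibre i1) * dy i1 f p + kronecker d (fibre i2) * dy i2 f p.
Proof.
  intros Sf Ap.
  assert (D : forall i, is_partial d (fun q => coord i (snd q) * dy i f q) p
    (kronecker d (fibre i) * dy i f p + coord i (snd p) * dy i (partial d f) p)).
  { intros i.
    replace (dy i (partial d f) p) with (partial d (dy i f) p)
      by exact (partial_comm A d (fibre i) f p oA Sf Ap).
    apply (is_partial_mult d (coordinate (fibre i))); [apply is_partial_coordinate|].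
    apply (smooth_on_is_partial A); [now apply smooth_on_dy|exact Ap]. }
  rewrite (is_partial_unique _ _ _ _ (is_partial_plus d _ _ p _ _ (D i1) (D i2))).
  unfold radial. cbv beta. ring.
Qed.

Lemma radial_partial (r : R) (d : direction) (f : tangent -> R) (p : tangent) :
  of_degree A r f -> A p ->
  radial (partial d f) p = r * partial d f p
    - kronecker d (fibre i1) * dy i1 f p - kronecker d (fibre i2) * dy i2 f p.
Proof.
  intros [Sf Ef] Ap.
  assert (E : partial d (radial f) p = r * partial d f p).
  { rewrite (partial_ext A d _ (fun q => r * f q) p oA Ap Ef).
    apply is_partial_unique. eapply is_partial_eq.
    - apply is_partial_mult; [apply is_partial_const|now apply (smooth_on_is_partial A)].
    - cbv beta. ring. }
  rewrite partial_radial // in E. lra.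
Qed.

Lemma of_degree_dx (r : R) (i : index) (f : tangent -> R) :
  of_degree A r f -> of_degree A r (dx i f).
Proof.
  intros Hf. split; [apply smooth_on_dx, Hf|]. intros p Ap.
  rewrite (radial_partial r (base i) f p Hf Ap). cbn.
  change (partial (base i) f p) with (dx i f p). ring.
Qed.

Lemma of_degree_dy (r : R) (i : index) (f : tangent -> R) :
  of_degree A r f -> of_degree A (r - 1) (dy i f).
Proof.
  intros Hf. split; [apply smooth_on_dy, Hf|]. intros p Ap.
  rewrite (radial_partial r (fibre i) f p Hf Ap).
  change (partial (fibre i) f p) with (dy i f p). destruct i; cbn; ring.
Qed.

End Degree.

(** * The geometry of the surface *)

Lemma is_partial_sqr (d : direction) (f : tangent -> R) (p : tangent) (a : R) :
  is_partial d f p a -> is_partial d (fun q => f q ^ 2) p (2 * f p * a).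
Proof.
  intros Ha. eapply is_partial_eq.
  - exact (is_derive_pow _ 2 _ _ Ha).
  - cbv beta. rewrite move_coordinate. cbn. ring.
Qed.

(** Derivative along [v = (- F_2, F_1)], which is tangent to the level curves
    of [F] in each fibre and equals [eps * sqrt (eps * det g) * m]. *)
Definition tangential (F f : tangent -> R) (p : tangent) : R :=
  dy i2 f p * dy i1 F p - dy i1 f p * dy i2 F p.

Definition root_det (F : tangent -> R) (eps : R) (p : tangent) : R :=
  sqrt (eps * det_g F p).

(** The covector [n] annihilating [y]; [m_low] is [root_det / F] times it. *)
Definition normal (i : index) (p : tangent) : R :=
  match i with i1 => - coord i2 (snd p) | i2 => coord i1 (snd p) end.

Section Surface.

Context (U : plane -> Prop) (A : tangent -> Prop) (F : tangent -> R) (eps : R)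
  (surf : conic_pseudo_Finsler_surface U A F eps).

Lemma surface_open : open A.
Proof. apply surf. Qed.

Let oA : open A := surface_open.

Lemma surface_smooth : smooth_on A F.
Proof. apply surf. Qed.

Lemma surface_degree : of_degree A 1 F.
Proof. apply homogeneous_of_degree; [exact oA|apply surf|apply surf]. Qed.

Lemma surface_neq0 (p : tangent) : A p -> F p <> 0.
Proof. apply surf. Qed.

Lemma surface_det_neq0 (p : tangent) : A p -> det_g F p <> 0.
Proof. apply surf. Qed.

Lemma signature_sqr : eps * eps = 1.
Proof. case: (surface_signature _ _ _ _ surf) => E; rewrite E; ring. Qed.

Lemma eps_det_pos (p : tangent) : A p -> 0 < eps * det_g F p.
Proof.
  intros Ap. generalize (surface_sign _ _ _ _ surf p Ap) (surface_det_neq0 p Ap).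
  destruct (Rlt_le_dec 0 (det_g F p)) as [H|H].
  - rewrite sign_eq_1 // => <- _. lra.
  - intros E N. assert (H' : det_g F p < 0) by lra.
    move: E. rewrite sign_eq_m1 // => <-. lra.
Qed.

Lemma root_det_pos (p : tangent) : A p -> 0 < root_det F eps p.
Proof. intros Ap. now apply sqrt_lt_R0, eps_det_pos. Qed.

Lemma det_root_det (p : tangent) : A p -> det_g F p = eps * root_det F eps p ^ 2.
Proof.
  intros Ap. unfold root_det. rewrite pow2_sqrt; [|now apply Rlt_le, eps_det_pos].
  rewrite -Rmult_assoc signature_sqr. ring.
Qed.

Lemma dy_sqr (i : index) (p : tangent) :
  A p -> dy i (fun q => F q ^ 2) p = 2 * F p * dy i F p.
Proof.
  intros Ap. apply dy_eq, is_partial_sqr.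
  exact (smooth_on_is_dy A F i p surface_smooth Ap).
Qed.

Lemma dx_sqr (i : index) (p : tangent) :
  A p -> dx i (fun q => F q ^ 2) p = 2 * F p * dx i F p.
Proof.
  intros Ap. apply dx_eq, is_partial_sqr.
  exact (smooth_on_is_dx A F i p surface_smooth Ap).
Qed.

Lemma g_eq (i j : index) (p : tangent) :
  A p -> g F i j p = dy i F p * dy j F p + F p * dy i (dy j F) p.
Proof.
  intros Ap. unfold g.
  rewrite (dy_ext A i _ _ p oA Ap (dy_sqr j)).
  rewrite (dy_eq i (fun q => 2 * F q * dy j F q) p
    ((0 * F p + 2 * dy i F p) * dy j F p + 2 * F p * dy i (dy j F) p)).
  - field.
  - apply is_partial_mult; [apply is_partial_mult; [apply is_partial_const|]|];
      apply (smooth_on_is_dy A); auto using surface_smooth, smooth_on_dy.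
Qed.

(** * Homogeneity of the metric tensor and of the spray *)

Lemma g_degree (i j : index) : of_degree A 0 (g F i j).
Proof.
  (* The degree is spelled out along the formula: a constant, the two factors of [F * F], and two
     fibre derivatives. *)
  unfold g. replace 0 with (0 + (1 + 1 - 1 - 1)) by ring.
  apply of_degree_mult; [exact oA|now apply of_degree_const|].
  repeat apply of_degree_dy; auto.
  apply (of_degree_ext A oA _ (fun q => F q * F q)); [intros; ring|].
  apply of_degree_mult; auto using surface_degree.
Qed.

Lemma det_degree : of_degree A 0 (det_g F).
Proof.
  unfold det_g. rewrite -(Rplus_0_r 0).
  apply of_degree_minus; auto; apply of_degree_mult; auto using g_degree.
Qed.

Lemma g_inv_degree (i j : index) : of_degree A 0 (g_inv F i j).
Proof.
  unfold g_inv. replace 0 with (0 + - 0) by ring.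
  apply of_degree_mult; [exact oA| |apply of_degree_inv; auto using surface_det_neq0, det_degree].
  destruct i, j; try apply g_degree;
    [apply (of_degree_ext A oA 0 (fun p => 0 - g F i1 i2 p))
    |apply (of_degree_ext A oA 0 (fun p => 0 - g F i2 i1 p))]; try (intros; ring);
    apply of_degree_minus; auto using g_degree, of_degree_const.
Qed.

(** Needed for the Euler identity [y^i dy_i G^j = 2 G^j], which removes the derivatives of the spray
    from [comma1]. *)
Lemma spray_degree (i : index) : of_degree A 2 (spray F i).
Proof.
  unfold spray, sum2.
  assert (S2 : of_degree A 2 (fun q => F q ^ 2)).
  { apply (of_degree_ext A oA _ (fun q => F q * F q)); [intros; ring|].
    apply of_degree_mult; auto using surface_degree. }
  replace 2 with (0 + (0 + (1 + (2 - 1)))) by ring.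
  apply of_degree_mult; [exact oA|now apply of_degree_const|].
  assert (H : forall j, of_degree A (1 + (2 - 1)) (fun p =>
    coord i1 (snd p) * dy j (dx i1 (fun q => F q ^ 2)) p
    + coord i2 (snd p) * dy j (dx i2 (fun q => F q ^ 2)) p - dx j (fun q => F q ^ 2) p)).
  { intros j. apply of_degree_minus; auto.
    - apply of_degree_plus; auto; apply of_degree_mult; auto using of_degree_coord;
        now apply of_degree_dy; [|apply of_degree_dx].
    - replace (1 + (2 - 1)) with 2 by ring. now apply of_degree_dx. }
  apply of_degree_plus; auto; apply of_degree_mult; auto using g_inv_degree.
Qed.

Lemma root_det_smooth : smooth_on A (root_det F eps).
Proof.
  apply smooth_on_sqrt; [exact oA|exact eps_det_pos|].
  apply smooth_on_mult; [exact oA|now apply smooth_on_const|apply det_degree].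
Qed.

Lemma euler_F (p : tangent) :
  A p -> coord i1 (snd p) * dy i1 F p + coord i2 (snd p) * dy i2 F p = F p.
Proof.
  intros Ap. generalize (proj2 surface_degree p Ap). unfold radial. lra.
Qed.

Lemma vector_sqr_neq0 (p : tangent) :
  A p -> coord i1 (snd p) ^ 2 + coord i2 (snd p) ^ 2 <> 0.
Proof.
  intros Ap. destruct p as [x [y1 y2]]. cbn [fst snd coord]. intros E.
  apply (conic_slit _ _ (metric_domain _ _ _ (surface_metric _ _ _ _ surf)) _ _ Ap).
  generalize (pow2_ge_0 y1) (pow2_ge_0 y2); intros H1 H2.
  f_equal; apply Rsqr_0_uniq; rewrite Rsqr_pow2; lra.
Qed.

(** The fibre Hessian of [F] kills [y], hence is a multiple of the square of the
    covector [(- y^2, y^1)]. *)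
Lemma hessian_rank1 (p : tangent) :
  A p -> exists c,
    dy i1 (dy i1 F) p = c * coord i2 (snd p) ^ 2 /\
    dy i1 (dy i2 F) p = - c * (coord i1 (snd p) * coord i2 (snd p)) /\
    dy i2 (dy i1 F) p = - c * (coord i1 (snd p) * coord i2 (snd p)) /\
    dy i2 (dy i2 F) p = c * coord i1 (snd p) ^ 2.
Proof.
  intros Ap.
  generalize (proj2 (of_degree_dy A oA _ i1 F surface_degree) p Ap)
    (proj2 (of_degree_dy A oA _ i2 F surface_degree) p Ap)
    (vector_sqr_neq0 p Ap).
  unfold radial. rewrite (dy_dy_comm A F i2 i1 p oA surface_smooth Ap).
  move: (coord i1 (snd p)) (coord i2 (snd p)) (dy i1 (dy i1 F) p)
    (dy i1 (dy i2 F) p) (dy i2 (dy i2 F) p) => y1 y2 a b c E1 E2 N.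
  (* The factor is found by taking traces: the trace of the square of [(- y2, y1)] is
     [y1 ^ 2 + y2 ^ 2]. *)
  exists ((a + c) / (y1 ^ 2 + y2 ^ 2)).
  assert (H : forall u w, u * (y1 ^ 2 + y2 ^ 2) = w -> u = w / (y1 ^ 2 + y2 ^ 2))
    by (intros u w <-; field; exact N).
  assert (H1 : y1 * a = - (y2 * b)) by lra.
  assert (H2 : y2 * c = - (y1 * b)) by lra.
  assert (H3 : y1 ^ 2 * a = y2 ^ 2 * c)
    by (transitivity (y1 * (y1 * a)); [ring|rewrite H1];
        transitivity (y2 * (y2 * c)); [rewrite H2|]; ring).
  assert (E3 : b = - ((a + c) / (y1 ^ 2 + y2 ^ 2)) * (y1 * y2)).
  { transitivity (- ((a + c) * (y1 * y2)) / (y1 ^ 2 + y2 ^ 2)); [apply H|field; exact N].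
    transitivity (- y2 * (y1 * a) - y1 * (y2 * c)); [rewrite H1 H2|]; ring. }
  repeat split; try exact E3.
  - transitivity (((a + c) * y2 ^ 2) / (y1 ^ 2 + y2 ^ 2)); [apply H|field; exact N].
    rewrite Rmult_plus_distr_l (Rmult_comm a (y1 ^ 2)) H3. ring.
  - transitivity (((a + c) * y1 ^ 2) / (y1 ^ 2 + y2 ^ 2)); [apply H|field; exact N].
    rewrite Rmult_plus_distr_l (Rmult_comm c (y2 ^ 2)) -H3. ring.
Qed.

(** The unknown factor [c] is read off from the determinant: [g_ij = F_i F_j + F c n_i n_j] has
    determinant [c F (y^i F_i)^2 = c F^3]. *)
Lemma hessian_eq (i j : index) (p : tangent) :
  A p -> dy i (dy j F) p = det_g F p / F p ^ 3 * (normal i p * normal j p).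
Proof.
  intros Ap. destruct (hessian_rank1 p Ap) as (c & H11 & H12 & H21 & H22).
  assert (D : det_g F p = c * F p ^ 3).
  { transitivity (c * (F p * (coord i1 (snd p) * dy i1 F p + coord i2 (snd p) * dy i2 F p) ^ 2)).
    - unfold det_g. rewrite !g_eq // H11 H12 H21 H22. ring.
    - now rewrite euler_F. }
  rewrite D. destruct i, j; rewrite ?H11 ?H12 ?H21 ?H22; cbn; field;
    now apply surface_neq0.
Qed.

(** The Hessian part of [g] kills [y], and Euler's identity evaluates the remaining term. *)
Lemma g_radial (j : index) (p : tangent) :
  A p -> g F j i1 p * coord i1 (snd p) + g F j i2 p * coord i2 (snd p) = F p * dy j F p.
Proof.
  intros Ap. rewrite !g_eq // -{3}euler_F //.
  destruct (hessian_rank1 p Ap) as (c & H11 & H12 & H21 & H22).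
  destruct j; rewrite ?H11 ?H12 ?H21 ?H22; ring.
Qed.

Lemma g_sym (p : tangent) : A p -> g F i2 i1 p = g F i1 i2 p.
Proof.
  intros Ap. rewrite !g_eq // (dy_dy_comm A F i2 i1 p oA surface_smooth Ap). ring.
Qed.


(** As [m_low] is a rotated multiple of [y], applying the adjugate of [g] to it amounts to rotating
    [g y], which [g_radial] evaluates; [m] thus becomes a multiple of [v = (- F_2, F_1)]. *)
Lemma m_up_eq (p : tangent) :
  A p -> m_up F eps i1 p = - eps * dy i2 F p / root_det F eps p /\
         m_up F eps i2 p = eps * dy i1 F p / root_det F eps p.
Proof.
  intros Ap. generalize (g_radial i1 p Ap) (g_radial i2 p Ap) (root_det_pos p Ap)
    (surface_neq0 p Ap) signature_sqr.
  unfold m_up, sum2, g_inv, m_low, ell_up. fold (root_det F eps p).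
  rewrite (g_sym p Ap) (det_root_det p Ap).
  move: (root_det F eps p) (g F i1 i1 p) (g F i1 i2 p) (g F i2 i2 p) (F p)
    (coord i1 (snd p)) (coord i2 (snd p)) (dy i1 F p) (dy i2 F p)
    => s g11 g12 g22 f y1 y2 f1 f2 E1 E2 /Rgt_not_eq Ns Nf ee.
  assert (Ne : eps <> 0) by (intros Z; rewrite Z in ee; lra).
  split.
  - transitivity (- (g12 * y1 + g22 * y2) / (eps * s * f)); [field; auto|].
    rewrite E2. transitivity (- (eps * eps) * f2 / (eps * s)); [rewrite ee|]; field; auto.
  - transitivity ((g11 * y1 + g12 * y2) / (eps * s * f)); [field; auto|].
    rewrite E1. transitivity ((eps * eps) * f1 / (eps * s)); [rewrite ee|]; field; auto.
Qed.

Lemma semi2_eq (f : tangent -> R) (p : tangent) :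
  A p -> semi2 F eps f p = F p / root_det F eps p * tangential F f p.
Proof.
  intros Ap. generalize (root_det_pos p Ap) signature_sqr => /Rgt_not_eq Ns ee.
  unfold semi2, sum2, tangential. destruct (m_up_eq p Ap) as [-> ->].
  transitivity (eps * eps * F p / root_det F eps p
    * (dy i2 f p * dy i1 F p - dy i1 f p * dy i2 F p)).
  - field. exact Ns.
  - rewrite ee. field. exact Ns.
Qed.

Lemma dy_g (i j k : index) (p : tangent) : dy k (g F i j) p = 2 * Cartan F i j k p.
Proof. unfold Cartan. field. Qed.

(** Jacobi's formula: since [dy_k g_ij = 2 I m_i m_j m_k / F] and [g^ij m_i m_j = eps], the
    logarithmic derivative of [root_det] is [eps I m_k / F]. Contracting with [v] uses
    [n(v) = F]. *)
Lemma tangential_root_det (I : tangent -> R) (p : tangent) :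
  is_main_scalar A F eps I -> A p ->
  tangential F (root_det F eps) p = eps * I p * root_det F eps p ^ 2 / F p.
Proof.
  intros HI Ap.
  assert (D : forall k, dy k (root_det F eps) p
    = eps * I p * root_det F eps p * m_low F eps k p / F p).
  { intros k.
    assert (Dg : forall i j, is_partial (fibre k) (g F i j) p
      (2 * (I p * m_low F eps i p * m_low F eps j p * m_low F eps k p) / F p)).
    { intros i j. eapply is_partial_eq.
      - apply (smooth_on_is_dy A); [apply g_degree|exact Ap].
      - rewrite dy_g -(HI p Ap). field. now apply surface_neq0. }
    apply dy_eq. unfold root_det at 1. eapply is_partial_eq.
    - apply is_partial_sqrt; [now apply eps_det_pos|].
      apply is_partial_mult; [apply is_partial_const|]. unfold det_g.
      apply is_partial_minus; apply is_partial_mult; apply Dg.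
    - cbv beta. fold (root_det F eps p).
      generalize (g_radial i1 p Ap) (g_radial i2 p Ap) (root_det_pos p Ap)
        (surface_neq0 p Ap) (euler_F p Ap).
      destruct k; unfold m_low, ell_up; fold (root_det F eps p);
      rewrite (g_sym p Ap);
      move: (root_det F eps p) (g F i1 i1 p) (g F i1 i2 p) (g F i2 i2 p) (F p) (I p)
        (coord i1 (snd p)) (coord i2 (snd p)) (dy i1 F p) (dy i2 F p)
        => s g11 g12 g22 f J y1 y2 f1 f2 E1 E2 /Rgt_not_eq Ns Nf E.
      (* The differentiated determinant is a multiple of [g(y, y)], which two uses of [g_radial] and
         Euler's identity turn into [F^2]. *)
      + transitivity (- eps * J * s ^ 2 * y2 / f ^ 4
          * ((g11 * y1 + g12 * y2) * y1 + (g12 * y1 + g22 * y2) * y2)); [field; auto|].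
        rewrite E1 E2.
        transitivity (- eps * J * s ^ 2 * y2 / f ^ 3 * (y1 * f1 + y2 * f2)); [|rewrite E]; field; auto.
      + transitivity (eps * J * s ^ 2 * y1 / f ^ 4
          * ((g11 * y1 + g12 * y2) * y1 + (g12 * y1 + g22 * y2) * y2)); [field; auto|].
        rewrite E1 E2.
        transitivity (eps * J * s ^ 2 * y1 / f ^ 3 * (y1 * f1 + y2 * f2)); [|rewrite E]; field; auto. }
  unfold tangential. rewrite !D. unfold m_low, ell_up. fold (root_det F eps p).
  generalize (surface_neq0 p Ap) => Nf.
  transitivity (eps * I p * root_det F eps p ^ 2 / F p ^ 2
    * (coord i1 (snd p) * dy i1 F p + coord i2 (snd p) * dy i2 F p)); [field; exact Nf|].
  rewrite euler_F //. field. exact Nf.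
Qed.


(** The terms produced by differentiating [sqrt (eps * det g)] are exactly
    those that the main scalar compensates. *)
Lemma semi2_semi2 (I phi : tangent -> R) (p : tangent) :
  is_main_scalar A F eps I -> of_degree A 0 phi -> A p ->
  semi2 F eps (semi2 F eps phi) p + eps * I p * semi2 F eps phi p
  = F p ^ 2 / root_det F eps p ^ 2
    * (dy i1 (dy i1 phi) p * dy i2 F p ^ 2
       - 2 * dy i1 (dy i2 phi) p * dy i1 F p * dy i2 F p
       + dy i2 (dy i2 phi) p * dy i1 F p ^ 2).
Proof.
  intros HI [Sphi Ephi] Ap.
  assert (D : forall k, dy k (semi2 F eps phi) p
    = (dy k F p * root_det F eps p - F p * dy k (root_det F eps) p) / root_det F eps p ^ 2
        * tangential F phi p
      + F p / root_det F eps p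
        * (dy k (dy i2 phi) p * dy i1 F p + dy i2 phi p * dy k (dy i1 F) p
           - (dy k (dy i1 phi) p * dy i2 F p + dy i1 phi p * dy k (dy i2 F) p))).
  { intros k. rewrite (dy_ext A k _ _ p oA Ap (semi2_eq phi)). apply dy_eq.
    apply is_partial_mult.
    - apply is_partial_div; [now apply Rgt_not_eq, root_det_pos| |];
        apply (smooth_on_is_dy A); auto using surface_smooth, root_det_smooth.
    - unfold tangential. apply is_partial_minus; apply is_partial_mult;
        apply (smooth_on_is_dy A); auto using surface_smooth, smooth_on_dy. }
  rewrite (semi2_eq (semi2 F eps phi)) // (semi2_eq phi) //.
  unfold tangential at 1. rewrite !D.
  generalize (tangential_root_det I p HI Ap) (root_det_pos p Ap) (surface_neq0 p Ap)
    (euler_F p Ap) (Ephi p Ap).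
  rewrite (dy_dy_comm A phi i2 i1 p oA Sphi Ap) !hessian_eq //.
  unfold tangential, radial, normal. set (c := det_g F p / F p ^ 3).
  move: c (root_det F eps p) (F p) (I p) (coord i1 (snd p)) (coord i2 (snd p))
    (dy i1 F p) (dy i2 F p) (dy i1 (root_det F eps) p) (dy i2 (root_det F eps) p)
    (dy i1 phi p) (dy i2 phi p)
    (dy i1 (dy i1 phi) p) (dy i1 (dy i2 phi) p) (dy i2 (dy i2 phi) p)
    => c s f J y1 y2 f1 f2 s1 s2 h1 h2 h11 h12 h22 Vs /Rgt_not_eq Ns Nf E Eh.
  (* The derivative of the factor [F] drops out because [v(F) = 0]. Of the four remaining groups,
     the second and third cancel by [tangential_root_det], and the last contains [y(phi) = 0]. *)
  transitivity (f ^ 2 / s ^ 2 * (h11 * f2 ^ 2 - 2 * h12 * f1 * f2 + h22 * f1 ^ 2)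
    - f ^ 2 / s ^ 3 * (h2 * f1 - h1 * f2) * (s2 * f1 - s1 * f2)
    + eps * J * (f / s * (h2 * f1 - h1 * f2))
    - f ^ 2 / s ^ 2 * c * (y1 * h1 + y2 * h2) * (y1 * f1 + y2 * f2)); [field; auto|].
  rewrite Vs Eh. field. auto.
Qed.

(** * The spray and the Euler-Lagrange equations *)

Lemma dy_dx_sqr (j k : index) (p : tangent) :
  A p -> dy j (dx k (fun q => F q ^ 2)) p
         = 2 * (dy j F p * dx k F p + F p * dx k (dy j F) p).
Proof.
  intros Ap. rewrite (dy_ext A j _ _ p oA Ap (dx_sqr k)). apply dy_eq. eapply is_partial_eq.
  - apply is_partial_mult; [apply is_partial_mult; [apply is_partial_const|]|];
      apply (smooth_on_is_dy A); auto using surface_smooth, smooth_on_dx.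
  - cbv beta. rewrite (dy_dx_comm A F j k p oA surface_smooth Ap). ring.
Qed.

(** Only the base part [y^k dx_k] of the geodesic spray, without the term [- 2 G^k dy_k]. *)
Definition spray_field (f : tangent -> R) (p : tangent) : R :=
  coord i1 (snd p) * dx i1 f p + coord i2 (snd p) * dx i2 f p.

Lemma spray_lower (i : index) (p : tangent) :
  A p -> 2 * (g F i i1 p * spray F i1 p + g F i i2 p * spray F i2 p)
         = dy i F p * spray_field F p + F p * (spray_field (dy i F) p - dx i F p).
Proof.
  intros Ap. generalize (surface_det_neq0 p Ap).
  unfold spray, sum2, spray_field, g_inv. rewrite !dy_dx_sqr // !dx_sqr //.
  unfold det_g. intros N. destruct i; field; exact N.
Qed.

Lemma radial_dx (k : index) (p : tangent) :
  A p -> coord i1 (snd p) * dx k (dy i1 F) p + coord i2 (snd p) * dx k (dy i2 F) p = dx k F p.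
Proof.
  intros Ap. generalize (proj2 (of_degree_dx A oA _ k F surface_degree) p Ap).
  unfold radial. rewrite !(dy_dx_comm A F _ _ p oA surface_smooth Ap). lra.
Qed.

(** [F] is constant along the geodesic spray. This is [spray_lower] contracted with [y]: by
    [radial_dx] the last bracket contributes nothing, by [g_radial] the left side is [2 F F_k G^k],
    and [F] cancels. *)
Lemma spray_field_F (p : tangent) :
  A p -> spray_field F p = 2 * (dy i1 F p * spray F i1 p + dy i2 F p * spray F i2 p).
Proof.
  intros Ap. apply (Rmult_eq_reg_l (F p)); [|now apply surface_neq0].
  transitivity (coord i1 (snd p) * (2 * (g F i1 i1 p * spray F i1 p + g F i1 i2 p * spray F i2 p))
    + coord i2 (snd p) * (2 * (g F i2 i1 p * spray F i1 p + g F i2 i2 p * spray F i2 p))).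
  - rewrite !spray_lower // -{1}euler_F //.
    transitivity (spray_field F p * (coord i1 (snd p) * dy i1 F p + coord i2 (snd p) * dy i2 F p)
      + F p * (coord i1 (snd p) * ((coord i1 (snd p) * dx i1 (dy i1 F) p
                                    + coord i2 (snd p) * dx i1 (dy i2 F) p) - dx i1 F p)
             + coord i2 (snd p) * ((coord i1 (snd p) * dx i2 (dy i1 F) p
                                    + coord i2 (snd p) * dx i2 (dy i2 F) p) - dx i2 F p))).
    + rewrite !radial_dx //. ring.
    + unfold spray_field. ring.
  - transitivity (2 * ((g F i1 i1 p * coord i1 (snd p) + g F i1 i2 p * coord i2 (snd p)) * spray F i1 p
      + (g F i2 i1 p * coord i1 (snd p) + g F i2 i2 p * coord i2 (snd p)) * spray F i2 p)).
    + rewrite g_sym //. ring.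
    + rewrite !g_radial //. ring.
Qed.

(** With [g_ij = F_i F_j + F F_ij] in [spray_lower], the terms containing [F_i] cancel by
    [spray_field_F]. *)
Lemma spray_hessian (i : index) (p : tangent) :
  A p -> spray_field (dy i F) p - dx i F p
         = 2 * (dy i (dy i1 F) p * spray F i1 p + dy i (dy i2 F) p * spray F i2 p).
Proof.
  intros Ap. apply (Rmult_eq_reg_l (F p)); [|now apply surface_neq0].
  generalize (spray_lower i p Ap). rewrite spray_field_F // !g_eq //. lra.
Qed.

(** Contracting [delta_i] with [y^i] meets [y^i dy_i G^j], which is [2 G^j] by homogeneity; the
    result is the full geodesic spray divided by [F]. *)
Lemma comma1_eq (f : tangent -> R) (p : tangent) :
  A p -> comma1 F f p
         = (spray_field f p - 2 * (spray F i1 p * dy i1 f p + spray F i2 p * dy i2 f p)) / F p.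
Proof.
  intros Ap. unfold comma1, delta, sum2, ell_up, spray_field.
  generalize (proj2 (spray_degree i1) p Ap) (proj2 (spray_degree i2) p Ap) (surface_neq0 p Ap).
  unfold radial. intros E1 E2 Nf.
  transitivity ((coord i1 (snd p) * dx i1 f p + coord i2 (snd p) * dx i2 f p
    - ((coord i1 (snd p) * dy i1 (spray F i1) p + coord i2 (snd p) * dy i2 (spray F i1) p) * dy i1 f p
     + (coord i1 (snd p) * dy i1 (spray F i2) p + coord i2 (snd p) * dy i2 (spray F i2) p) * dy i2 f p))
    / F p).
  - field. exact Nf.
  - rewrite E1 E2. field. exact Nf.
Qed.

Lemma comma2_eq (f : tangent -> R) (p : tangent) :
  A p -> comma2 F eps f p
         = (delta F i2 f p * dy i1 F p - delta F i1 f p * dy i2 F p) / root_det F eps p.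
Proof.
  intros Ap. unfold comma2, sum2. destruct (m_up_eq p Ap) as [-> ->].
  generalize (root_det_pos p Ap) => /Rgt_not_eq Ns.
  transitivity (eps * eps * ((delta F i2 f p * dy i1 F p - delta F i1 f p * dy i2 F p) / root_det F eps p)).
  - field. exact Ns.
  - rewrite signature_sqr. ring.
Qed.

End Surface.

(** * The conformal change *)

Section Conformal.

Context (A : tangent -> Prop) (oA : open A) (F phi : tangent -> R)
  (SF : smooth_on A F) (Sphi : smooth_on A phi).

Lemma Fbar_smooth : smooth_on A (Fbar F phi).
Proof. apply smooth_on_mult; [exact oA|now apply smooth_on_exp|exact SF]. Qed.

Lemma partial_Fbar (d : direction) (p : tangent) :
  A p -> is_partial d (Fbar F phi) p (exp (phi p) * (F p * partial d phi p + partial d F p)).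
Proof.
  intros Ap. unfold Fbar. eapply is_partial_eq.
  - apply is_partial_mult; [apply is_partial_exp|]; now apply (smooth_on_is_partial A).
  - cbv beta. ring.
Qed.

Lemma dx_Fbar (i : index) (p : tangent) :
  A p -> dx i (Fbar F phi) p = exp (phi p) * (F p * dx i phi p + dx i F p).
Proof. intros Ap. exact (dx_eq _ _ _ _ (partial_Fbar (base i) p Ap)). Qed.

Lemma dy_Fbar (i : index) (p : tangent) :
  A p -> dy i (Fbar F phi) p = exp (phi p) * (F p * dy i phi p + dy i F p).
Proof. intros Ap. exact (dy_eq _ _ _ _ (partial_Fbar (fibre i) p Ap)). Qed.

Lemma dx_dy_Fbar (i j : index) (p : tangent) :
  A p -> dx j (dy i (Fbar F phi)) p
         = exp (phi p) * (dx j phi p * (F p * dy i phi p + dy i F p)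
             + dx j F p * dy i phi p + F p * dx j (dy i phi) p + dx j (dy i F) p).
Proof.
  intros Ap. rewrite (dx_ext A j _ _ p oA Ap (dy_Fbar i)). apply dx_eq. eapply is_partial_eq.
  - apply is_partial_mult; [apply is_partial_exp|apply is_partial_plus; [apply is_partial_mult|]];
      apply (smooth_on_is_dx A); auto using smooth_on_dy.
  - cbv beta. ring.
Qed.

(** The positive factor [exp(phi)] is cancelled, and the derivatives of [F] are grouped into the two
    combinations evaluated by [spray_field_F] and [spray_hessian]. *)
Lemma projectively_flat_Fbar (i : index) (p : tangent) :
  projectively_flat A (Fbar F phi) -> A p ->
  spray_field phi p * (F p * dy i phi p + dy i F p) + dy i phi p * spray_field F p
    + F p * (spray_field (dy i phi) p - dx i phi p) + (spray_field (dy i F) p - dx i F p) = 0.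
Proof.
  intros flat Ap. apply (Rmult_eq_reg_l (exp (phi p))); [|apply Rgt_not_eq, exp_pos].
  generalize (flat p Ap i). unfold sum2. rewrite !dx_dy_Fbar // dx_Fbar //.
  unfold spray_field. lra.
Qed.

Lemma projectively_flat_of_dx_eq0 :
  (forall p, A p -> forall j, F p * dx j phi p + dx j F p = 0) ->
  projectively_flat A (Fbar F phi).
Proof.
  intros H p Ap i.
  assert (D : forall j q, A q -> dx j (Fbar F phi) q = 0)
    by (intros j q Aq; rewrite dx_Fbar // H //; ring).
  assert (D2 : forall j, dx j (dy i (Fbar F phi)) p = 0).
  (* After exchanging the derivatives, a function vanishing on the whole open set [A] is
     differentiated along the fibre. *)
  { intros j. rewrite -(dy_dx_comm A _ i j p oA Fbar_smooth Ap).
    rewrite (dy_ext A i _ (fun _ => 0) p oA Ap (D j)).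
    apply dy_eq, is_partial_const. }
  unfold sum2. rewrite !D2 D //. ring.
Qed.

End Conformal.

(** * Projective flatness of the conformal metric *)

Theorem theorem4p5 :
  forall (U : plane -> Prop) (A : tangent -> Prop) (F : tangent -> R) (eps : R)
         (I phi : tangent -> R),
    open U ->
    conic_pseudo_Finsler_surface U A F eps ->
    is_main_scalar A F eps I ->
    smooth_on A phi ->
    homogeneous_on A 0 phi ->
    (forall p, A p ->
       sigma_phi F eps I phi p + eps - semi2 F eps phi p ^ 2 <> 0) ->
    (projectively_flat A (Fbar F phi) ->
     forall p, A p ->
       Q_phi F eps I phi p + eps * sum2 (fun k => spray F k p * m_low F eps k p) = 0)
    /\
    ((forall p, A p -> forall j, F p * dx j phi p + dx j F p = 0) ->
     projectively_flat A (Fbar F phi)).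
Proof.
  intros U A F eps I phi _ surf HI Sphi Hphi nondeg.
  assert (oA := surface_open U A F eps surf).
  assert (SF := surface_smooth U A F eps surf).
  assert (dphi := homogeneous_of_degree A 0 phi oA Sphi Hphi).
  split; [|exact (projectively_flat_of_dx_eq0 A oA F phi SF Sphi)].
  intros flat p Ap.
  assert (flat1 := projectively_flat_Fbar A oA F phi SF Sphi i1 p flat Ap).
  assert (flat2 := projectively_flat_Fbar A oA F phi SF Sphi i2 p flat Ap).
  (* From here on the base derivatives of [F] are replaced by spray coefficients. *)
  rewrite (spray_field_F U A F eps surf p Ap) (spray_hessian U A F eps surf _ p Ap) in flat1.
  rewrite (spray_field_F U A F eps surf p Ap) (spray_hessian U A F eps surf _ p Ap) in flat2.
  assert (S22 := semi2_semi2 U A F eps surf I phi p HI dphi Ap).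
  set (G1 := spray F i1) in *. set (G2 := spray F i2) in *.
  assert (SG1 : smooth_on A G1) by exact (proj1 (spray_degree U A F eps surf i1)).
  assert (SG2 : smooth_on A G2) by exact (proj1 (spray_degree U A F eps surf i2)).
  assert (D1 : forall k, dy k (comma1 F phi) p
    = (((dx k phi p + spray_field (dy k phi) p)
        - 2 * (dy k G1 p * dy i1 phi p + G1 p * dy k (dy i1 phi) p
             + (dy k G2 p * dy i2 phi p + G2 p * dy k (dy i2 phi) p))) * F p
       - (spray_field phi p - 2 * (G1 p * dy i1 phi p + G2 p * dy i2 phi p)) * dy k F p)
      / F p ^ 2).
  { intros k. rewrite (dy_ext A k _ _ p oA Ap (comma1_eq U A F eps surf phi)).
    fold G1 G2. apply dy_eq. apply is_partial_div.
    - now apply (surface_neq0 U A F eps surf).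
    - apply is_partial_minus.
      + eapply is_partial_eq.
        * unfold spray_field. apply is_partial_plus.
          -- apply (is_partial_mult _ (coordinate (fibre i1)));
               [apply is_partial_coordinate|].
             apply (smooth_on_is_dy A); auto using smooth_on_dx.
          -- apply (is_partial_mult _ (coordinate (fibre i2)));
               [apply is_partial_coordinate|].
             apply (smooth_on_is_dy A); auto using smooth_on_dx.
        * rewrite !(dy_dx_comm A phi k _ p oA Sphi Ap).
          unfold spray_field. destruct k; cbn; ring.
      + eapply is_partial_eq.
        * apply is_partial_mult; [apply is_partial_const|].
          apply is_partial_plus; apply is_partial_mult;
            apply (smooth_on_is_dy A); auto using smooth_on_dy.
        * cbv beta. ring.
    - now apply (smooth_on_is_dy A). }
  assert (N := nondeg p Ap).
  unfold Q_phi, rho_phi. unfold sigma_phi in *.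
  set (Dn := _ + eps - semi2 F eps phi p ^ 2) in *.
  (* [Dn] is [1 / rho]. The square of [phi_;2] survives once from [2 - 1], and [eps] is absorbed as
     [det g / root_det^2]. *)
  assert (EDn : Dn = F p ^ 2 / root_det F eps p ^ 2
    * (dy i1 (dy i1 phi) p * dy i2 F p ^ 2
       - 2 * dy i1 (dy i2 phi) p * dy i1 F p * dy i2 F p
       + dy i2 (dy i2 phi) p * dy i1 F p ^ 2
       + tangential F phi p ^ 2 + det_g F p / F p ^ 2)).
  { unfold Dn. rewrite S22 (semi2_eq U A F eps surf phi) //.
    rewrite (det_root_det U A F eps surf p Ap). field.
    split; [now apply (surface_neq0 U A F eps surf)|].
    now apply Rgt_not_eq, (root_det_pos U A F eps surf). }
  clearbody Dn. clear S22 nondeg flat.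
  set (B := semi2 F eps phi p * comma1 F phi p + _ - _).
  assert (EB : F p ^ 3 * B = - 2 * root_det F eps p * Dn
    * (coord i1 (snd p) * G2 p - coord i2 (snd p) * G1 p)).
  { unfold B. rewrite !(semi2_eq U A F eps surf) // (comma2_eq U A F eps surf) //.
    rewrite (comma1_eq U A F eps surf) // EDn.
    unfold tangential. rewrite !D1. unfold delta, sum2. fold G1 G2.
    generalize (euler_F U A F eps surf p Ap) (proj2 dphi p Ap)
      (proj2 (of_degree_dy A oA _ i1 phi dphi) p Ap)
      (proj2 (of_degree_dy A oA _ i2 phi dphi) p Ap)
      (root_det_pos U A F eps surf p Ap) (surface_neq0 U A F eps surf p Ap).
    rewrite !(hessian_eq U A F eps surf) // in flat1 flat2.
    unfold radial. cbn [normal] in flat1, flat2.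
    rewrite (dy_dy_comm A phi i2 i1 p oA Sphi Ap).
    set (c := det_g F p / F p ^ 3) in *.
    replace (det_g F p / F p ^ 2) with (c * F p)
      by (unfold c; field; now apply (surface_neq0 U A F eps surf)).
    move: c (root_det F eps p) (F p) (coord i1 (snd p)) (coord i2 (snd p))
      (dy i1 F p) (dy i2 F p) (dy i1 phi p) (dy i2 phi p)
      (dy i1 (dy i1 phi) p) (dy i1 (dy i2 phi) p) (dy i2 (dy i2 phi) p)
      (G1 p) (G2 p) (spray_field phi p)
      (dx i1 phi p) (dx i2 phi p)
      (spray_field (dy i1 phi) p) (spray_field (dy i2 phi) p)
      (dy i1 G1 p) (dy i1 G2 p) (dy i2 G1 p) (dy i2 G2 p)
      flat1 flat2 {D1 EDn N B}
      => c s f y1 y2 f1 f2 h1 h2 h11 h12 h22 g1 g2 X x1 x2 X1 X2 g11 g12 g21 g22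
         flat1 flat2 E Eh E1 E2 /Rgt_not_eq Ns Nf.
    (* The decomposition [F G = (G^k F_k) y + n(G) v], applied to [phi]; its [y] part vanishes since
       [phi] has degree 0. *)
    assert (HG : f * (g1 * h1 + g2 * h2) = (y1 * g2 - y2 * g1) * (h2 * f1 - h1 * f2)).
    { rewrite -E. transitivity ((y1 * g2 - y2 * g1) * (h2 * f1 - h1 * f2)
        + (f1 * g1 + f2 * g2) * (y1 * h1 + y2 * h2)); [|rewrite Eh]; ring. }
    (* The same decomposition in the first slot of the Hessian of [phi], with [v] in the second. The
       [y] part now survives, because [dy_i phi] has degree -1. *)
    assert (HZ : f * ((g1 * h12 + g2 * h22) * f1 - (g1 * h11 + g2 * h12) * f2)
      = (y1 * g2 - y2 * g1) * (h11 * f2 ^ 2 - 2 * h12 * f1 * f2 + h22 * f1 ^ 2)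
        - (f1 * g1 + f2 * g2) * (h2 * f1 - h1 * f2)).
    { rewrite -E. transitivity (
        (y1 * g2 - y2 * g1) * (h11 * f2 ^ 2 - 2 * h12 * f1 * f2 + h22 * f1 ^ 2)
        + (f1 * g1 + f2 * g2) * ((y1 * h12 + y2 * h22) * f1 - (y1 * h11 + y2 * h12) * f2));
        [|rewrite E1 E2]; ring. }
    (* The two flatness equations contracted with [v]; the term [X F_i] disappears because
       [v(F) = 0]. *)
    assert (HT : f * (X * (h2 * f1 - h1 * f2) + (X2 - x2) * f1 - (X1 - x1) * f2)
      = - 2 * ((f1 * g1 + f2 * g2) * (h2 * f1 - h1 * f2)
               + c * (y1 * g2 - y2 * g1) * (y1 * f1 + y2 * f2))).
    { apply Rminus_diag_uniq. transitivity (0 * f1 - 0 * f2); [|ring].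
      rewrite -{1}flat2 -flat1. ring. }
    rewrite E in HT.
    (* In the expanded bracket the derivatives of the spray cancel between [phi_,1;2] and
       [2 phi_,2]; what is left consists of the left sides of [HT], [HG] and [HZ]. *)
    transitivity (f ^ 2 / s
      * (f * (X * (h2 * f1 - h1 * f2) + (X2 - x2) * f1 - (X1 - x1) * f2)
         - 2 * (h2 * f1 - h1 * f2) * (f * (g1 * h1 + g2 * h2))
         - 2 * (f * ((g1 * h12 + g2 * h22) * f1 - (g1 * h11 + g2 * h12) * f2))));
      [|rewrite HT HG HZ]; field; auto. }
  rewrite /m_low /sum2 -/G1 -/G2 /ell_up -/(root_det F eps p).
  assert (Nf := surface_neq0 U A F eps surf p Ap).
  (* The first term is [Q], the second is [eps G^k m_k] with [m_k = root_det n_k / F]; [EB] makes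
     them opposite. *)
  transitivity (eps / (2 * F p * Dn) * (F p ^ 3 * B)
   + eps * root_det F eps p * (coord i1 (snd p) * G2 p - coord i2 (snd p) * G1 p) / F p);
   [|rewrite EB]; field; auto.
Qed.
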